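(* Let $n\geq 1$ be a fixed integer. For each $f\in C[0,1]$ we have $$\lim_{\varrho\to\infty} L_n^{\varrho}f = L_n f \quad\text{uniformly on } [0,1],$$ where $L_n^{\varrho}$ is the Lagrange-type operator associated with $U_n^{\varrho}$ and $L_n$ is the classical Lagrange interpolation operator on the nodes $0,\frac1n,\dots,\frac{n-1}{n},1$.
   Context: $\Pi_n$ denotes the space of real polynomials of degree at most $n$ (viewed as functions on $[0,1]$), and $B(\cdot,\cdot)$ is the Euler Beta function. For real $\varrho>0$ and an integer $n\geq 1$, define functionals $F_{n,k}^{\varrho}:C[0,1]\to\mathbb{R}$, $k=0,\dots,n$, by $$F_{n,0}^{\varrho}(f)=f(0),\quad F_{n,n}^{\varrho}(f)=f(1),\quad F_{n,k}^{\varrho}(f)=\int_0^1\frac{t^{k\varrho-1}(1-t)^{(n-k)\varrho-1}}{B(k\varrho,(n-k)\varrho)}f(t)\,dt,\ 1\leq k\leq n-1.$$ The operator $U_n^{\varrho}:C[0,1]\to\Pi_n$ is $U_n^{\varrho}(f;x)=\sum_{k=0}^n F_{n,k}^{\varrho}(f)\,p_{n,k}(x)$, with $p_{n,k}(x)=\binom nk x^k(1-x)^{n-k}$. The restriction $U_n^{\varrho}|_{\Pi_n}:\Pi_n\to\Pi_n$ is invertible, and $L_n^{\varrho}:C[0,1]\to\Pi_n$ is defined by $L_n^{\varrho}=(U_n^{\varrho}|_{\Pi_n})^{-1}\circ U_n^{\varrho}$. Equivalently, $L_n^{\varrho}f$ is the unique polynomial in $\Pi_n$ with $F_{n,k}^{\varrho}(L_n^{\varrho}f)=F_{n,k}^{\varrho}(f)$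 for $k=0,\dots,n$. $L_nf$ is the unique polynomial in $\Pi_n$ with $L_nf(k/n)=f(k/n)$, $k=0,\dots,n$. *)

(* Defs.v *)
From mathcomp Require Import all_boot all_order all_algebra.
From mathcomp Require Import all_classical all_reals all_analysis.

Set Implicit Arguments.
Unset Strict Implicit.
Unset Printing Implicit Defensive.

Import Order.TTheory GRing.Theory Num.Theory.
Import numFieldNormedType.Exports.

Local Open Scope classical_set_scope.
Local Open Scope ring_scope.

Section Operators.
Context {R : realType}.
Implicit Types (n k : nat) (rho a b : R) (f : R -> R).

Local Notation mu := (@lebesgue_measure R).

(* A function f in C[0,1] is represented by any total f : R -> R whose
   restriction to [0,1] is continuous; only its values on [0,1] are used.
   For real exponents, 0 `^ x is 0 when x != 0, so for negative exponents the
   integrands below take the value 0 at a singular endpoint, which does not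
   affect the Lebesgue integral. *)

Definition betaR a b : R :=
  \int[mu]_(t in `[0, 1]) (t `^ (a - 1) * (1 - t) `^ (b - 1)).

Definition Ffun n rho k f : R :=
  if k == 0%N then f 0
  else if k == n then f 1
  else \int[mu]_(t in `[0, 1])
    (t `^ (k%:R * rho - 1) * (1 - t) `^ ((n - k)%:R * rho - 1)
       / betaR (k%:R * rho) ((n - k)%:R * rho) * f t).

Definition bernstein n k : {poly R} :=
  ('X ^+ k * (1 - 'X) ^+ (n - k)) *+ 'C(n, k).

Definition Pi n : set {poly R} := [set p | (size p <= n.+1)%N].

Definition Uop n rho f : {poly R} :=
  \sum_(k < n.+1) Ffun n rho k f *: bernstein n k.

Definition Urestr n rho (p : {poly R}) : {poly R} := Uop n rho (horner p).

(* 'pinv_dflt A g is the inverse of g restricted to A; the default value is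
   only used outside of the image g @` A. *)
Definition Lop n rho f : {poly R} :=
  'pinv_(fun=> 0) (Pi n) (Urestr n rho) (Uop n rho f).

Definition node n k : R := k%:R / n%:R.

Definition lagrange_interp n f : {poly R} :=
  \sum_(k < n.+1) f (node n k) *: (tnth (n.+1.-lagrange (node n)) k : {poly R}).

Lemma Uop_Pi n rho f : Pi n (Uop n rho f).
Proof.
rewrite /Pi /Uop /=; apply: (big_ind (fun p : {poly R} => (size p <= n.+1)%N)).
- by rewrite size_poly0.
- by move=> p q hp hq; rewrite (leq_trans (size_polyD _ _))// geq_max hp.
move=> [k kn] _ /=; apply: (leq_trans (size_scale_leq _ _)).
rewrite /bernstein -mulr_natl -polyC_natr mul_polyC.
apply: (leq_trans (size_scale_leq _ _)).
have h : size (1 - 'X : {poly R}) = 2%N.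
  by rewrite -opprB size_polyN size_XsubC.
have h0 : 1 - 'X != 0 :> {poly R} by rewrite -size_poly_eq0 h.
rewrite size_mul ?expf_neq0 ?polyX_eq0// size_polyXn.
have := size_poly_exp_leq (1 - 'X : {poly R}) (n - k).
rewrite h mul1n => le1.
by rewrite addSn /= -[X in (_ <= X.+1)%N](subnKC (kn : (k <= n)%N)) -addnS leq_add2l.
Qed.

Lemma node_inj n : (0 < n)%N -> injective (node n).
Proof.
move=> n0 i j /(congr1 (fun x => x * n%:R)).
rewrite /node !divfK ?pnatr_eq0 -?lt0n//.
by move/eqP; rewrite eqr_nat => /eqP.
Qed.

Lemma lagrange_interpP n f (p : {poly R}) : (0 < n)%N ->
  p = lagrange_interp n f <->
  Pi n p /\ (forall k, (k <= n)%N -> p.[node n k] = f (node n k)).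
Proof.
move=> n0; have ninj := node_inj n0; split=> [->|[pn pk]].
  split.
    apply: (big_ind (fun p : {poly R} => (size p <= n.+1)%N)).
    - by rewrite size_poly0.
    - by move=> q r hq hr; rewrite (leq_trans (size_polyD _ _))// geq_max hq.
    by move=> k _; rewrite (leq_trans (size_scale_leq _ _))// size_npoly.
  move=> k kn; rewrite /lagrange_interp horner_sum.
  pose k' : 'I_n.+1 := Ordinal (n:=n.+1) (m:=k) kn.
  rewrite (bigD1 k')//= hornerZ (lagrange_sample (n := n.+1) _ ninj _ k')// eqxx mulr1.
  rewrite big1 ?addr0// => j jk.
  by rewrite hornerZ (lagrange_sample (n := n.+1) _ ninj _ k')// (negbTE jk) mulr0.
rewrite (lagrange_gen (n := n.+1) _ ninj pn)//; apply: eq_bigr => k _.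
by rewrite mul_polyC pk// -ltnS.
Qed.

End Operators.

(* Main.v *)
(* With a = k rho and b = (n - k) rho, the Beta density defining F_{n,k} has mean
   k/n, and integrating the derivative of t^a (1-t)^b (t - k/n) shows that its
   variance is at most 1/(n rho). Chebyshev's argument then gives
   F_{n,k}(g) -> g(k/n) for every continuous g. Hence the matrix of the functionals
   in the Lagrange basis tends to the identity: for large rho it is invertible with
   inverse bounded by 2 in the sup norm, and the node values of
   L_n^rho f - L_n f are at most 2 max_k |F_{n,k}(f) - F_{n,k}(L_n f)|, which tends
   to 2 max_k |f(k/n) - L_n f(k/n)| = 0. *)
Require Import Defs.
From mathcomp Require Import all_boot all_order all_algebra.
From mathcomp Require Import all_classical all_reals all_analysis.
From mathcomp Require Import ring lra.

Import Order.TTheory GRing.Theory Num.Theory.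
Import numFieldNormedType.Exports.

Local Open Scope classical_set_scope.
Local Open Scope ring_scope.

(** * Calculus and continuity on the unit interval *)

Section UnitInterval.
Context {R : realType}.
Implicit Types (f g F G : R -> R).

Local Notation mu := (@lebesgue_measure R).
Local Notation smooth01 F := (derivable_oo_LRcontinuous F 0 1).

Lemma derivable_LRcontinuousM F G :
  smooth01 F -> smooth01 G -> smooth01 (fun t => F t * G t).
Proof.
move=> [dF F0 F1] [dG G0 G1]; split; [|exact: cvgM..].
by move=> z z01; apply: derivableM; [exact: dF|exact: dG].
Qed.

Lemma derivable_cvg F (x : R) : derivable F x 1 -> F t @[t --> x] --> F x.
Proof. by move=> dF; apply/differentiable_continuous/derivable1_diffP. Qed.

Lemma derivable_LRcontinuous_derivable F :
  (forall x, derivable F x 1) -> smooth01 F.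
Proof.
move=> dF; have cF x := derivable_cvg _ _ (dF x).
by split; [move=> x _| apply: cvg_at_right_filter | apply: cvg_at_left_filter].
Qed.

(** For e < 1 the derivative blows up at 0, so differentiability is only available inside the
    interval; at 0 a one-sided limit takes its place. *)
Lemma derivable_LRcontinuous_powR (e : R) :
  0 < e -> smooth01 (fun t => t `^ e).
Proof.
move=> e0; split.
- move=> z; rewrite in_itv/= => /andP[z0 _].
  by apply: derivable_powR; rewrite in_itv/= z0.
- by rewrite powR0 ?gt_eqF//; exact: powR_cvg0.
- apply: cvg_at_left_filter; apply: (derivable_cvg (fun t => t `^ e)).
  by apply: derivable_powR; rewrite in_itv/= ltr01.
Qed.

Lemma derivable_LRcontinuous_onem_powR (e : R) :
  0 < e -> smooth01 (fun t => (1 - t) `^ e).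
Proof.
move=> e0.
have d1 (z : R) : z < 1 -> derivable (fun t : R => (1 - t) `^ e) z 1.
  move=> z1; apply/derivable1_diffP.
  apply: (@differentiable_comp _ _ _ _ (fun t : R => 1 - t) (fun t => t `^ e)) => //.
  apply/derivable1_diffP/derivable_powR.
  by rewrite in_itv/= andbT subr_gt0.
split.
- by move=> z; rewrite in_itv/= => /andP[_ z1]; exact: d1.
- apply: cvg_at_right_filter; apply: (derivable_cvg (fun t => (1 - t) `^ e)).
  by apply: d1; exact: ltr01.
- rewrite subrr powR0 ?gt_eqF//.
  (* The left limit at 1 is the right limit of t^e at 0, reflected by t -> 1 - t. *)
  have /cvgrPdist_lt h := powR_cvg0 e0.
  apply/cvgrPdist_lt => eps eps0; have [d /= d0 hd] := h _ eps0.
  exists d => //= z /= zd z1.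
  apply: hd; rewrite /= ?subr_gt0//.
  by rewrite sub0r normrN.
Qed.

Lemma continuous01_integrable f : {within `[0, 1], continuous f} ->
  mu.-integrable `[0, 1] (EFin \o f).
Proof. by move=> cf; apply: continuous_compact_integrable => //; exact: segment_compact. Qed.

Lemma within_continuousM f g (A : set R) : {within A, continuous f} ->
  {within A, continuous g} -> {within A, continuous (fun t => f t * g t)}.
Proof. by move=> cf cg x; apply: cvgM; [exact: cf|exact: cg]. Qed.

Lemma Rintegral_FTC01 f F : {within `[0, 1], continuous f} -> smooth01 F ->
  (forall t : R, 0 < t < 1 -> is_derive t (1 : R) F (f t)) ->
  \int[mu]_(t in `[0, 1]) f t = F 1 - F 0.
Proof.
move=> cf sF F'; rewrite /Rintegral (continuous_FTC2 ltr01 cf sF)//.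
by move=> t; rewrite in_itv/= derive1E => /F'[_ ->].
Qed.

Lemma horner_continuous01 (p : {poly R}) : {within `[0, 1], continuous (horner p)}.
Proof. by apply: continuous_subspaceT => x; exact: continuous_horner. Qed.

(** Within the distance d given by continuity at x, eps suffices; farther away (t - x)^2 / d^2 is at
    least 1, so the maximum of |g - g x| over d^2 serves as K. Integrated against a Beta weight, the
    bound involves only its mass and its variance. *)
Lemma continuous01_quadratic_bound g (x eps : R) : {within `[0, 1], continuous g} ->
  0 <= x <= 1 -> 0 < eps ->
  exists2 K : R, 0 <= K &
    forall t, 0 <= t <= 1 -> `|g t - g x| <= eps + K * (t - x) ^+ 2.
Proof.
move=> cg x01 eps0.
have cabs : {within `[0, 1], continuous (fun t => `|g t - g x|)}.
  by move=> t; apply: cvg_norm; apply: cvgB; [exact: cg|exact: cvg_cst].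
have [c _ cmax] := EVT_max (@ler01 R) cabs.
have xI : `[0, 1]%classic x by rewrite /= in_itv.
have /subspace_continuousP/(_ _ xI)/cvgrPdist_lt/(_ _ eps0)[d /= d0 hd] := cg.
exists (`|g c - g x| / d ^+ 2); first by rewrite divr_ge0// sqr_ge0.
move=> t t01; have tI : t \in `[0, 1]%R by rewrite in_itv.
have [tx|tx] := ltP `|x - t| d.
  apply: (@le_trans _ _ eps); last first.
    by rewrite lerDl mulr_ge0 ?divr_ge0 ?sqr_ge0.
  by rewrite distrC ltW//; apply: hd.
apply: (le_trans (cmax _ tI)); apply: ler_wpDl; first exact: ltW.
rewrite mulrAC ler_pdivlMr ?exprn_gt0// ler_wpM2l//.
by rewrite -[leRHS]real_normK ?num_real// distrC lerXn2r ?nnegrE// ltW.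
Qed.

End UnitInterval.

(** * Beta weights: positivity, variance and concentration *)

Section BetaWeight.
Context {R : realType}.
Implicit Types (a b : R) (g : R -> R).

Local Notation mu := (@lebesgue_measure R).

Definition beta_weight a b (t : R) : R := t `^ (a - 1) * (1 - t) `^ (b - 1).

Lemma beta_weight_ge0 a b t : 0 <= beta_weight a b t.
Proof. by rewrite mulr_ge0 ?powR_ge0. Qed.

(** Both exponents are positive, so the weight has no endpoint singularity and integrability reduces
    to continuity. For rho > 1 every interior index k is in this case. *)
Lemma beta_weight_continuous a b : 1 < a -> 1 < b ->
  {within `[0, 1], continuous (beta_weight a b)}.
Proof.
move=> a1 b1; apply: within_continuousM; apply: derivable_oo_LRcontinuous_within.
  by apply: derivable_LRcontinuous_powR; rewrite subr_gt0.
by apply: derivable_LRcontinuous_onem_powR; rewrite subr_gt0.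
Qed.

(** On [1/4, 3/4] both t and 1 - t are at least 1/4, so the weight is at least the positive constant
    [c] there. *)
Lemma betaR_gt0 a b : 1 < a -> 1 < b -> 0 < betaR a b.
Proof.
move=> a1 b1; pose c : R := 4^-1 `^ (a - 1) * 4^-1 `^ (b - 1).
have c0 : 0 < c by rewrite mulr_gt0// powR_gt0// invr_gt0.
have iw := continuous01_integrable _ (beta_weight_continuous a b a1 b1).
rewrite -lte_fin /betaR /Rintegral fineK; last exact: integrable_fin_num.
pose J : set R := `[4^-1, 3 / 4]%classic.
have mJ : measurable J by exact: measurable_itv.
have s01 : J `<=` `[(0 : R), 1]%classic.
  by move=> t /=; rewrite /J /= !in_itv/= => /andP[? ?]; apply/andP; split; lra.
apply: (@lt_le_trans _ _ (\int[mu]_(t in J) c%:E)%E).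
  rewrite integral_cst//= /J lebesgue_measure_itv/= lte_fin ifT; last by lra.
  by rewrite -EFinD -EFinM lte_fin mulr_gt0//; lra.
apply: (@le_trans _ _ (\int[mu]_(t in J) (beta_weight a b t)%:E)%E).
  apply: ge0_le_integral => //.
  - by move=> t _; rewrite lee_fin ltW.
  - by apply: (measurable_funS _ s01 (measurable_int _ iw)) => //.
  - move=> t; rewrite /J /= in_itv/= => /andP[t1 t2]; rewrite lee_fin.
    by apply: ler_pM; rewrite ?powR_ge0//; apply: ge0_ler_powR;
      rewrite ?nnegrE; lra.
apply: ge0_subset_integral => //.
- by move: (measurable_int _ iw).
by move=> t _; rewrite lee_fin beta_weight_ge0.
Qed.

Lemma powR_mul_pred (t e : R) : 0 < t -> t `^ e = t * t `^ (e - 1).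
Proof.
move=> t0; rewrite -[in LHS](subrK 1 e) [LHS]powRD; last by rewrite (gt_eqF t0) implybT.
by rewrite powRr1 ?ltW// mulrC.
Qed.

(* Integrate [t^a (1-t)^b (t-x)], which vanishes at both endpoints; its derivative
   is the weight times [t(1-t) - (a+b)(t-x)^2]. *)
Lemma beta_weight_variance a b (x : R) : 1 < a -> 1 < b -> x = a / (a + b) ->
  \int[mu]_(t in `[0, 1]) (beta_weight a b t * (t - x) ^+ 2) <= (a + b)^-1 * betaR a b.
Proof.
move=> a1 b1 xE; have s0 : 0 < a + b by lra.
have cw := beta_weight_continuous _ _ a1 b1.
have cpoly (p : {poly R}) :
    {within `[0, 1], continuous (fun t => beta_weight a b t * p.[t])}.
  by apply: within_continuousM cw _; exact: horner_continuous01.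
pose v : {poly R} := ('X - x%:P) ^+ 2.
pose u : {poly R} := 'X * (1 - 'X).
pose F t : R := t `^ a * (1 - t) `^ b * (t - x).
have F0 : F 1 - F 0 = 0.
  by rewrite /F subrr !powR0 ?gt_eqF ?(lt_trans _ a1) ?(lt_trans _ b1)// mulr0 !mul0r subrr.
have E t : (beta_weight a b t * (u - (a + b) *: v).[t]) =
   beta_weight a b t * u.[t] - (a + b) * (beta_weight a b t * v.[t]).
  by rewrite hornerD hornerN hornerZ; ring.
have : \int[mu]_(t in `[0, 1]) (beta_weight a b t * (u - (a + b) *: v).[t]) = 0.
  rewrite -[RHS]F0; apply: Rintegral_FTC01 => //.
    apply: derivable_LRcontinuousM; first apply: derivable_LRcontinuousM.
    - by apply: derivable_LRcontinuous_powR; lra.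
    - by apply: derivable_LRcontinuous_onem_powR; lra.
    - by apply: derivable_LRcontinuous_derivable => t; exact: ex_derive.
  move=> t /andP[t0 t1].
  have d1 := is_derive1_powR a t0.
  have t1' : 0 < 1 - t by lra.
  have d2' := is_derive1_powR b t1'.
  have d2 : is_derive t (1 : R) (fun t => (1 - t) `^ b) (- (b * (1 - t) `^ (b - 1))).
    have := @is_derive1_comp _ (fun t => t `^ b) (fun t => 1 - t) t _ (- 1) d2' _.
    rewrite mulrN1; apply.
    by apply: is_derive_eq; rewrite add0r mul1r.
  have d3 : is_derive t (1 : R) (fun t => t - x) 1 by apply: is_derive_eq; rewrite subr0.
  have dF := is_deriveM (is_deriveM d1 d2) d3.
  apply: (is_derive_eq dF); rewrite fctE.
  have -> : t `^ a = t * t `^ (a - 1).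
    exact: powR_mul_pred.
  have -> : (1 - t) `^ b = (1 - t) * (1 - t) `^ (b - 1).
    exact: powR_mul_pred.
  (* Up to the weight, the derivative is (a(1-t) - bt)(t-x) + t(1-t), and a(1-t) - bt = -(a+b)(t-x)
     by the value of x. *)
  rewrite /beta_weight /u /v !hornerE /= xE /GRing.scale/=; field; lra.
under eq_Rintegral do rewrite E.
rewrite RintegralB//; last 2 first.
- exact: continuous01_integrable.
- apply: continuous01_integrable; apply: within_continuousM; last exact: cpoly.
  by move=> ?; exact: cvg_cst.
rewrite RintegralZl//; last exact: continuous01_integrable.
move/eqP; rewrite subr_eq0 => /eqP uv.
rewrite [leRHS]mulrC ler_pdivlMr//.
have vE t : v.[t] = (t - x) ^+ 2 by rewrite /v !hornerE.
under eq_Rintegral do rewrite -vE.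
rewrite mulrC -uv; apply: le_Rintegral => //; try exact: continuous01_integrable.
move=> t /=; rewrite in_itv/= => /andP[t0 t1].
(* The bound t(1-t) <= 1 is what gives the constant 1/(a+b). *)
rewrite -[leRHS]mulr1 ler_wpM2l ?beta_weight_ge0// /u !hornerE.
nra.
Qed.

Lemma mem_node n k : (k <= n)%N -> 0 <= (node n k : R) <= 1.
Proof.
move=> kn; rewrite /node divr_ge0//=; have [->|n0] := posnP n.
  by rewrite invr0 mulr0.
by rewrite ler_pdivrMr ?ltr0n// mul1r ler_nat.
Qed.

Lemma beta_weightM_integrable a b : 1 < a -> 1 < b -> forall f : R -> R,
  {within `[0, 1], continuous f} ->
  mu.-integrable `[0, 1] (EFin \o (fun t => beta_weight a b t * f t)).
Proof.
move=> a1 b1 f cf; apply: continuous01_integrable.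
by apply: within_continuousM cf; exact: beta_weight_continuous.
Qed.

Lemma beta_params_gt1 n k (rho : R) : (0 < k < n)%N -> 1 < rho ->
  1 < k%:R * rho /\ 1 < (n - k)%:R * rho.
Proof.
move=> /andP[k0 kn] rho1; have rho0 : 0 <= rho by lra.
by split; rewrite (lt_le_trans rho1)// ler_peMl// ler1n// subn_gt0.
Qed.

Lemma FfunE n rho k g : (0 < k < n)%N -> 1 < rho ->
  {within `[0, 1], continuous g} ->
  Ffun n rho k g = (betaR (k%:R * rho) ((n - k)%:R * rho))^-1 *
    \int[mu]_(t in `[0, 1]) (beta_weight (k%:R * rho) ((n - k)%:R * rho) t * g t).
Proof.
move=> kn rho1 cg; have [a1 b1] := beta_params_gt1 _ _ _ kn rho1.
move: kn => /andP[k0 kn]; rewrite /Ffun gtn_eqF// ltn_eqF//.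
rewrite -RintegralZl//; last exact: beta_weightM_integrable.
by apply: eq_Rintegral => t _; rewrite /beta_weight; ring.
Qed.

(** On polynomials integrability is automatic, so linearity of the integral applies; the two extreme
    indices are point evaluations. *)
Lemma Ffun_horner_linear n rho k : (k <= n)%N -> 1 < rho ->
  linear (fun p : {poly R} => Ffun n rho k (horner p) : R^o).
Proof.
move=> kn rho1 c p q; have [->|k0] := posnP k.
  by rewrite /Ffun eqxx !hornerE.
have [->|nk] := eqVneq k n; first by rewrite /Ffun eqxx; case: eqP; rewrite !hornerE.
have k1 : (0 < k < n)%N by rewrite k0 ltn_neqAle nk.
have [a1 b1] := beta_params_gt1 _ _ _ k1 rho1.
have iwM r := beta_weightM_integrable _ _ a1 b1 _ (horner_continuous01 r).
rewrite !FfunE//; try exact: horner_continuous01.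
set w := beta_weight _ _ in iwM *.
have E t : w t * (c *: p + q).[t] = w t * (c *: p).[t] + w t * q.[t].
  by rewrite hornerD mulrDr.
have E' t : w t * (c *: p).[t] = c * (w t * p.[t]) by rewrite hornerZ mulrCA.
under eq_Rintegral do rewrite E; rewrite RintegralD//.
under eq_Rintegral do rewrite E'; rewrite RintegralZl//.
by rewrite /GRing.scale/= mulrDr mulrCA.
Qed.

(** The extreme functionals do not depend on rho. For the others, the quadratic bound and the
    variance give an error of at most eps/2 + K/(n rho). *)
Lemma Ffun_cvg n k g : (k <= n)%N -> {within `[0, 1], continuous g} ->
  Ffun n rho k g @[rho --> +oo] --> g (node n k).
Proof.
move=> kn cg; have [->|k0] := eqVneq k 0%N.
  by rewrite /Ffun eqxx /node mul0r; exact: cvg_cst.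
have [kE|kn'] := eqVneq k n.
  by rewrite /Ffun (negPf k0) kE eqxx /node divff ?pnatr_eq0 -?kE//; exact: cvg_cst.
have {kn kn'}ltkn : (k < n)%N by rewrite ltn_neqAle kn' kn.
set x := node n k; have x01 : 0 <= x <= 1 by exact/mem_node/ltnW.
have n0 : 0 < n%:R :> R by rewrite ltr0n (leq_ltn_trans _ ltkn).
apply/cvgrPdist_le => eps eps0.
have k1 : (0 < k < n)%N by rewrite lt0n k0.
have e2 : 0 < eps / 2 by rewrite divr_gt0.
have [K K0 hK] := continuous01_quadratic_bound g x (eps / 2) cg x01 e2.
near=> rho.
have rho1 : 1 < rho by near: rho; exact: nbhs_pinfty_gt.
(* This threshold amounts to K/(n rho) <= eps/2. *)
have rhoK : 2 * K / eps / n%:R <= rho by near: rho; apply: nbhs_pinfty_ge; exact: num_real.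
set a := k%:R * rho; set b := (n - k)%:R * rho.
have [a1 b1] : 1 < a /\ 1 < b by exact: beta_params_gt1.
have abE : a + b = n%:R * rho by rewrite -mulrDl -natrD subnKC// ltnW.
have xE : x = a / (a + b).
  rewrite abE /a /x /node; field; apply/andP; split; lra.
have B0 := betaR_gt0 a b a1 b1; set B := betaR a b in B0 *.
have cw := beta_weight_continuous a b a1 b1.
have cgx : {within `[0, 1], continuous (fun t => g t - g x)}.
  by move=> t; apply: cvgB; [exact: cg|exact: cvg_cst].
have cagx : {within `[0, 1], continuous (fun t => `|g t - g x|)}.
  by move=> t; apply: cvg_norm; exact: cgx.
have iwM := beta_weightM_integrable a b a1 b1.
have iw : mu.-integrable `[0, 1] (EFin \o beta_weight a b).
  exact: continuous01_integrable.
have wB : \int[mu]_(t in `[0, 1]) beta_weight a b t = B by [].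
rewrite FfunE// -/a -/b -/B.
(* The normalized weight has mass 1, so the constant g x can be moved under the integral. *)
rewrite distrC (_ : _ - g x =
    B^-1 * \int[mu]_(t in `[0, 1]) (beta_weight a b t * (g t - g x))); last first.
  under [in RHS]eq_Rintegral do rewrite mulrBr.
  rewrite RintegralB//; [|exact: iwM|by apply: iwM => ?; exact: cvg_cst].
  by rewrite RintegralZr// wB; field; rewrite gt_eqF.
rewrite normrM gtr0_norm ?invr_gt0// ler_pdivrMl//.
apply: (le_trans (le_normr_Rintegral _ _)) => //; first exact: iwM.
(* The majorant is encoded as a polynomial to get its continuity, hence integrability, from
   [horner_continuous01]. *)
pose p : {poly R} := (eps / 2)%:P + K *: ('X - x%:P) ^+ 2.
have pE t : p.[t] = eps / 2 + K * (t - x) ^+ 2 by rewrite /p !hornerE.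
apply: (@le_trans _ _ (\int[mu]_(t in `[0, 1]) (beta_weight a b t * p.[t]))).
  apply: le_Rintegral => //.
  - apply: eq_integrable (iwM _ cagx) => // t _ /=.
    by rewrite normrM (ger0_norm (beta_weight_ge0 _ _ _)).
  - by apply: iwM; exact: horner_continuous01.
  - move=> t /=; rewrite in_itv/= => t01.
    rewrite normrM ger0_norm ?beta_weight_ge0// ler_wpM2l ?beta_weight_ge0//.
    by rewrite pE hK.
have wpE t : beta_weight a b t * p.[t] =
    eps / 2 * beta_weight a b t + K * (beta_weight a b t * (t - x) ^+ 2).
  by rewrite pE; ring.
under eq_Rintegral do rewrite wpE.
have iv : mu.-integrable `[0, 1]
    (EFin \o (fun t => beta_weight a b t * (t - x) ^+ 2)).
  apply: eq_integrable (iwM _ (horner_continuous01 (('X - x%:P) ^+ 2))) => // t _.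
  by rewrite /= !hornerE.
have icM (c : R) (f : R -> R) : mu.-integrable `[0, 1] (EFin \o f) ->
    mu.-integrable `[0, 1] (EFin \o (fun t => c * f t)).
  by move=> /(integrableZl _ c); apply.
rewrite RintegralD//; [|exact: icM|exact: icM].
rewrite !RintegralZl// wB.
have := beta_weight_variance a b x a1 b1 xE.
rewrite -/B abE => var.
have -> : B * eps = eps / 2 * B + eps / 2 * B by field.
rewrite lerD// (le_trans (ler_wpM2l K0 var))// mulrA ler_wpM2r ?(ltW B0)//.
have nr0 : 0 < n%:R * rho by rewrite mulr_gt0//; lra.
rewrite ler_pdivrMr//.
move: rhoK; rewrite ler_pdivrMr// ler_pdivrMr// => rhoK; nra.
Unshelve. all: by end_near. Qed.
End BetaWeight.

(** * Independence of Bernstein polynomials; matrices close to the identity *)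

Section LagrangeType.
Context {R : realType}.

(* Multiplying [p.[t/(1+t)]] by [(1+t)^n] turns a Bernstein expansion into a
   monomial one. *)
Lemma bernstein_free n (c : nat -> R) :
  \sum_(k < n.+1) c k *: bernstein n k = 0 -> forall k, (k <= n)%N -> c k = 0.
Proof.
move=> c0; pose P := \poly_(i < n.+1) (c i * 'C(n, i)%:R).
have P0 (m : nat) : P.[m%:R] = 0.
  have m1 : 1 + m%:R != 0 :> R by rewrite addrC natr1 pnatr_eq0.
  have := congr1 (fun p : {poly R} => (1 + m%:R) ^+ n * p.[m%:R / (1 + m%:R)]) c0.
  rewrite horner0 mulr0 horner_sum mulr_sumr => <-; rewrite horner_poly.
  apply: eq_bigr => -[k /= kn] _; rewrite hornerZ /bernstein hornerMn.
  rewrite -[in RHS]mulr_natr !hornerE /=.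
  have -> : 1 - m%:R / (1 + m%:R) = (1 + m%:R)^-1 :> R by field.
  rewrite -{2}(subnKC (kn : (k <= n)%N)) exprD !exprMn !exprVn.
  by field; rewrite !expf_neq0.
have {}P0 : P = 0.
  (* The n+1 distinct roots 0, ..., n exceed the degree of [P]. *)
  apply: (@roots_geq_poly_eq0 _ _ [seq i%:R | i <- iota 0 n.+1]).
  - by apply/allP => _ /mapP[i _ ->]; apply/rootP.
  - by rewrite map_inj_uniq ?iota_uniq//; exact: mulrIn (oner_neq0 _).
  - by rewrite size_map size_iota size_poly.
move=> k kn; have := congr1 (fun p : {poly R} => p`_k) P0.
rewrite coef0 coef_poly ltnS kn => /eqP.
by rewrite mulf_eq0 pnatr_eq0 -leqn0 leqNgt bin_gt0 kn orbF => /eqP.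
Qed.

(** With this tolerance each row of A - I has absolute sum at most 1/2. *)
Definition near_identity {N} (A : 'M[R]_N) : Prop :=
  forall i j, `|A i j - (i == j)%:R| <= (2 * N%:R)^-1.

(** At an index i where |v i| is maximal, the row sum of A - I gives |v i| <= M + |v i|/2. *)
Lemma near_identity_bound N (A : 'M[R]_N) (v : 'I_N -> R) (M : R) :
  near_identity A -> (forall i, `|\sum_j A i j * v j| <= M) ->
  forall i, `|v i| <= 2 * M.
Proof.
move=> nA vM i0; have N0 : (0 < N)%N by case: i0 => i; exact: leq_ltn_trans.
pose i := [arg max_(i > i0) `|v i|]%O.
have vmax j : `|v j| <= `|v i|.
  by rewrite /i; case: Order.TotalTheory.arg_maxP => // k _; exact.
have : `|v i| <= M + `|v i| / 2; last by have := vmax i0; lra.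
rewrite {1}(_ : v i = \sum_j A i j * v j - \sum_j (A i j - (i == j)%:R) * v j); last first.
  rewrite -sumrB (bigD1 i)//= eqxx big1 ?addr0 ?mulr1n; first by ring.
  by move=> j /negPf ji; rewrite eq_sym ji mulr0n; ring.
apply: (le_trans (ler_normB _ _)); rewrite lerD// (le_trans (ler_norm_sum _ _ _))//.
have -> : `|v i| / 2 = \sum_(j < N) (2 * N%:R)^-1 * `|v i|.
  rewrite sumr_const card_ord -[RHS]mulr_natr; field.
  by rewrite pnatr_eq0 -lt0n.
by apply: ler_sum => j _; rewrite normrM ler_pM.
Qed.

(** The previous bound with M = 0 makes the kernel trivial; the transpose appears because row
    freeness concerns row vectors multiplied on the left. *)
Lemma near_identity_unit N (A : 'M[R]_N) : near_identity A -> A \in unitmx.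
Proof.
move=> nA; rewrite -unitmx_tr -row_free_unit; apply: inj_row_free => v vA.
apply/rowP => i; rewrite mxE; apply/eqP; rewrite -normr_le0 -[leRHS](mulr0 2).
apply: (near_identity_bound _ _ (fun j => v 0 j) _ nA) => k.
rewrite (_ : \sum_j _ = 0) ?normr0//.
have /rowP/(_ k) := vA; rewrite !mxE => vAk; rewrite -[RHS]vAk.
by apply: eq_bigr => j _; rewrite mxE mulrC.
Qed.


(** * The Lagrange-type operator as the solution of a linear system *)

Section Lop.
Variables (n : nat).
Hypothesis n0 : (0 < n)%N.

Local Notation basis j := (tnth (n.+1.-lagrange (node n)) j : {poly R}).

(** This matrix sends the node values of a polynomial in [Pi n] to its functionals when rho > 1. *)
Definition lagrange_moments rho : 'M[R]_n.+1 :=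
  \matrix_(k, j) Ffun n rho k (horner (basis j)).

Lemma Pi_lagrange (p : {poly R}) : Pi n p ->
  p = \sum_(j < n.+1) p.[node n j] *: basis j.
Proof.
move=> pn; rewrite {1}(lagrange_gen (n := n.+1) _ (node_inj n0) pn)//.
by apply: eq_bigr => j _; rewrite mul_polyC.
Qed.

Lemma lagrange_Pi (c : 'I_n.+1 -> R) : Pi n (\sum_j c j *: basis j).
Proof.
apply: (big_ind (fun p : {poly R} => (size p <= n.+1)%N)).
- by rewrite size_poly0.
- by move=> q r hq hr; rewrite (leq_trans (size_polyD _ _))// geq_max hq.
- by move=> k _; rewrite (leq_trans (size_scale_leq _ _))// size_npoly.
Qed.

Lemma Ffun_lagrange rho (k : 'I_n.+1) (c : 'I_n.+1 -> R) : 1 < rho ->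
  Ffun n rho k (horner (\sum_j c j *: basis j)) =
  \sum_j lagrange_moments rho k j * c j.
Proof.
move=> rho1; have lin := @Ffun_horner_linear R _ _ _ (ltn_ord k : (k <= n)%N) rho1.
(* Linearity with scalar -1 at the zero polynomials gives the value 0. *)
have F0 : Ffun n rho k (horner (0 : {poly R})) = 0.
  by have := lin (-1) 0 0; rewrite scaler0 addr0 => ->; rewrite scaleN1r addNr.
apply: (big_rec2 (fun p y => Ffun n rho k (horner p) = y)) => // j y p _ <-.
by rewrite lin mxE mulrC.
Qed.

(** Entry (k, j) tends to the j-th basis polynomial at node k, a Kronecker delta; finitely many
    entries share one threshold. *)
Lemma lagrange_moments_cvg :
  \forall rho \near +oo, near_identity (lagrange_moments rho).
Proof.
apply: filter_forall => k; apply: filter_forall => j.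
have kn : (k <= n)%N by rewrite -ltnS.
have := @Ffun_cvg R n k _ kn (horner_continuous01 (basis j)).
rewrite (lagrange_sample (n := n.+1) _ (node_inj n0))//.
move=> /cvgrPdist_le/(_ (2 * n.+1%:R)^-1) h.
have /h : 0 < (2 * n.+1%:R)^-1 :> R by rewrite invr_gt0 mulr_gt0.
by apply: filterS => rho; rewrite mxE eq_sym distrC.
Qed.

Lemma node_bound rho (p : {poly R}) (M : R) : 1 < rho ->
  near_identity (lagrange_moments rho) -> Pi n p ->
  (forall k : 'I_n.+1, `|Ffun n rho k (horner p)| <= M) ->
  forall k : 'I_n.+1, `|p.[node n k]| <= 2 * M.
Proof.
move=> rho1 nA pn FM.
apply: (near_identity_bound _ _ (fun k : 'I_n.+1 => p.[node n k]) _ nA) => k.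
by rewrite -Ffun_lagrange// -Pi_lagrange.
Qed.

(** The functionals are the Bernstein coefficients of [Uop], and these are unique. *)
Lemma Uop_inj (rho : R) (f g : R -> R) : Uop n rho f = Uop n rho g ->
  forall k, (k <= n)%N -> Ffun n rho k f = Ffun n rho k g.
Proof.
move=> /eqP; rewrite -subr_eq0 /Uop -sumrB => /eqP UE k kn; apply/eqP.
rewrite -subr_eq0; apply/eqP.
apply: (bernstein_free n (fun k => Ffun n rho k f - Ffun n rho k g) _ k kn).
by rewrite -[RHS]UE; apply: eq_bigr => i _; rewrite scalerBl.
Qed.

Lemma Ffun_hornerB rho (k : 'I_n.+1) (p q : {poly R}) : 1 < rho ->
  Ffun n rho k (horner (p - q)) = Ffun n rho k (horner p) - Ffun n rho k (horner q).
Proof.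
move=> rho1; have := @Ffun_horner_linear R _ _ _ (ltn_ord k : (k <= n)%N) rho1 (-1) q p.
by rewrite scaleN1r [- q + p]addrC => ->; rewrite scaleN1r addrC.
Qed.

Lemma PiB (p q : {poly R}) : Pi n p -> Pi n q -> Pi n (p - q).
Proof.
by move=> pn qn; rewrite /Pi/= (leq_trans (size_polyD _ _))// size_polyN geq_max pn.
Qed.

(** All functionals of p - q vanish, so [node_bound] with M = 0 annihilates its node values. *)
Lemma Urestr_inj rho : 1 < rho -> near_identity (lagrange_moments rho) ->
  {in Pi n &, injective (Urestr n rho : {poly R} -> {poly R})}.
Proof.
move=> rho1 nA p q; rewrite !inE => pn qn /Uop_inj FE.
have pqn := PiB _ _ pn qn.
apply/eqP; rewrite -subr_eq0 (Pi_lagrange _ pqn) big1// => k _.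
have := node_bound rho _ 0 rho1 nA pqn _ k; rewrite mulr0 normr_le0 => /(_ _)/eqP ->.
  by rewrite scale0r.
by move=> i; rewrite Ffun_hornerB// (FE i (ltn_ord i)) subrr normr0.
Qed.

(** Inverting the moment matrix produces a polynomial with the prescribed functionals; injectivity
    identifies it with [Lop]. *)
Lemma LopP rho (f : R -> R) : 1 < rho -> near_identity (lagrange_moments rho) ->
  Pi n (Lop n rho f) /\
  forall k, (k <= n)%N -> Ffun n rho k (horner (Lop n rho f)) = Ffun n rho k f.
Proof.
move=> rho1 nA; have Au := near_identity_unit _ _ nA.
pose b : 'cV[R]_n.+1 := \col_k Ffun n rho k f.
pose c := invmx (lagrange_moments rho) *m b.
pose p : {poly R} := \sum_j c j 0 *: basis j.
have pn : Pi n p by exact: lagrange_Pi.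
have Fp k : (k <= n)%N -> Ffun n rho k (horner p) = Ffun n rho k f.
  move=> kn; have -> : k = @Ordinal n.+1 k kn by [].
  rewrite Ffun_lagrange//.
  have /colP/(_ (@Ordinal n.+1 k kn)) : lagrange_moments rho *m c = b by rewrite mulKVmx.
  by rewrite !mxE.
have -> : Lop n rho f = p; last by split.
(* Since [Uop n rho f] lies in the image of [Pi n], the default value of ['pinv_] never enters. *)
rewrite /Lop (_ : Uop n rho f = Urestr n rho p).
  by apply: pinvKV; [exact: Urestr_inj|rewrite inE].
by apply: eq_bigr => k _; rewrite Fp// -ltnS.
Qed.
End Lop.
End LagrangeType.

(** * From the functionals to uniform convergence *)

Theorem theorem2p1 (R : realType) (n : nat) (n_ge1 : (1 <= n)%N)
    (f : R -> R) (f_cont : {within `[0, 1], continuous f}) :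
  {uniform `[0, 1],
    (fun rho : R => horner (Lop n rho f)) @ +oo --> horner (lagrange_interp n f)}.
Proof.
set q := lagrange_interp n f.
have [qn qf] := (lagrange_interpP f q n_ge1).1 erefl.
pose L (j : 'I_n.+1) : {poly R} := tnth (n.+1.-lagrange (node n)) j.
have Lbd (j : 'I_n.+1) : exists B, forall t, 0 <= t <= 1 -> `|(L j).[t]| <= B.
  have cL : {within `[0, 1], continuous (fun t => `|(L j).[t]|)}.
    by move=> t; apply: cvg_norm; exact: horner_continuous01.
  have [c _ cmax] := EVT_max (@ler01 R) cL.
  by exists `|(L j).[c]| => t t01; apply: cmax; rewrite in_itv.
have [B LB] := choice Lbd.
pose C := \sum_j B j.
have C0 : 0 <= C.
  by apply: sumr_ge0 => j _; apply: le_trans (LB j 0 _); rewrite ?normr_ge0 ?lexx ?ler01.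
move=> P /uniform_nbhs[E [entE EP]].
move: entE; rewrite -entourage_ballE => -[e /= e0 eE].
(* Node errors of at most 2d, weighted by the bounds [B j], add up to 2dC < e; C + 1 keeps the
   denominator positive when C = 0. *)
pose d := e / (4 * (C + 1)).
have d0 : 0 < d by rewrite divr_gt0// mulr_gt0//; lra.
have closeF (k : 'I_n.+1) :
    \forall rho \near +oo, `|Ffun n rho k f - Ffun n rho k (horner q)| <= d.
  have kn : (k <= n)%N by rewrite -ltnS.
  have cvf := @Ffun_cvg R n k f kn f_cont.
  have cvq := @Ffun_cvg R n k _ kn (horner_continuous01 q).
  (* As q interpolates f, both sequences of functionals have the same limit. *)
  rewrite qf// in cvq.
  have : Ffun n rho k f - Ffun n rho k (horner q) @[rho --> +oo] --> (0 : R).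
    by rewrite -(subrr (f (node n k))); exact: cvgB.
  move=> /cvgrPdist_le/(_ _ d0).
  by apply: filterS => rho; rewrite sub0r normrN.
near=> rho; apply: EP => t; rewrite /= in_itv/= => t01; apply: eE => /=.
have rho1 : 1 < rho by near: rho; exact: nbhs_pinfty_gt.
have nA : near_identity (lagrange_moments n rho).
  by near: rho; exact: lagrange_moments_cvg.
have dF : forall k : 'I_n.+1, `|Ffun n rho k f - Ffun n rho k (horner q)| <= d.
  by near: rho; exact: filter_forall closeF.
have [pn Fp] := LopP n n_ge1 rho f rho1 nA.
have pqn := PiB n _ _ pn qn.
(* [Lop] preserves the functionals of f, so those of [Lop n rho f - q] are the differences already
   bounded by d. *)
have bd : forall k : 'I_n.+1, `|(Lop n rho f - q).[node n k]| <= 2 * d.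
  apply: (node_bound n n_ge1 rho _ d rho1 nA pqn) => i.
  by rewrite Ffun_hornerB// (Fp i (ltn_ord i)).
rewrite /ball/= distrC -hornerN -hornerD (Pi_lagrange n n_ge1 _ pqn) horner_sum.
apply: (le_lt_trans (ler_norm_sum _ _ _)).
apply: (@le_lt_trans _ _ (\sum_j 2 * d * B j)).
  by apply: ler_sum => j _; rewrite hornerZ normrM ler_pM//; exact: LB.
rewrite -mulr_sumr -/C /d.
have -> : 2 * (e / (4 * (C + 1))) * C = e * (C / (2 * (C + 1))) by field; lra.
by rewrite gtr_pMr// ltr_pdivrMr; lra.
Unshelve. all: by end_near. Qed.
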